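(* Let $Y(u)\in\mathbb{R}^m_{>0}$, $u\in[0,\infty)$, be a nonconstant solution of $\frac{dY_i}{du}=-Y_iF_i(Y)$, $1\le i\le m$, with $\lim_{u\to\infty}Y(u)=\xi$, and let $g_{a,\vec b}(\tau)$ be the corresponding ancient solution of the Ricci flow on the circle bundle $P_Q$. Then for any $\epsilon>0$ small enough there is a $\tau_0>0$ such that for $\tau\ge\tau_0$ and each $i$ $$\left(2p_i-q_i^2(\xi_i+\epsilon)\right)(\tau-\tau_0)\le b_i(\tau)-b_i(\tau_0)\le\left(2p_i-q_i^2(\xi_i-\epsilon)\right)(\tau-\tau_0),$$ $$(E(\xi)-\epsilon)(\tau-\tau_0)\le a(\tau)-a(\tau_0)\le(E(\xi)+\epsilon)(\tau-\tau_0).$$ Hence $$\lim_{\tau\to\infty}\frac{a(\tau)}{\tau}=E(\xi),\qquad\lim_{\tau\to\infty}\frac{b_i(\tau)}{\tau}=E(\xi)\,\xi_i^{-1}.$$ Geometrically, as $\tau\to\infty$, the circle bundle $P_Q$, equipped with the metric $\tau^{-1}g_{a,\vec b}(\tau)$, converges to a multiple of the Einstein metric corresponding to $\xi$.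
   Context: For $1\le i\le m$, $(M_i,g_i)$ is a compact Kähler–Einstein manifold of complex dimension $n_i$, $\mathrm{Rc}(g_i)=p_ig_i$ with $p_i$ a positive integer, with Kähler form $\omega_i$, scaled so that $\frac1{2\pi}[\omega_i]$ is integral and represents a torsion-free indivisible class in $H^2(M_i,\mathbb{Z})$. Let $q_1,\dots,q_m$ be nonzero integers and $P_Q\to M_1\times\cdots\times M_m$ the principal circle bundle with Euler class $\frac1{2\pi}\sum_iq_i[\omega_i]$, with principal connection $\sigma$ of curvature form $d\sigma=\sum_iq_i\omega_i$. Consider metrics $g_{a,\vec b}(\tau)=a(\tau)\,\sigma\otimes\sigma+\sum_ib_i(\tau)g_i$, $a,b_i>0$ ($g_i$ pulled back). With $\tau=-t$ the backwards Ricci flow for $g_{a,\vec b}(\tau)$ is $$\frac{da}{d\tau}=\sum_{i}n_iq_i^2\frac{a^2}{b_i^2},\qquad \frac{db_i}{d\tau}=2p_i-q_i^2\frac{a}{b_i}.$$ An ancient solution is one existing for all $t\in(-\infty,T)$ for some finite $T$. Put $Y_i=a/b_i$, $u=\int_0^\tau\frac{d\zeta}{a(\zeta)}$, $E(Y)=\sum_in_iq_i^2Y_i^2$, $F_i(Y)=2p_iY_i-q_i^2Y_i^2-E(Y)$. Then the flow becomes $\frac{d\ln a}{du}=E(Y)$, $\frac{dY_i}{du}=-Y_iF_i(Y)$. Conversely, a solution $Y(u)\in\mathbb{R}^m_{>0}$ and a choice of $a(0)>0$ determine the corresponding $g_{a,\vec b}(\tau)$ by $a(u)=a(0)\exp\int_0^uE(Y(\zeta))d\zeta$,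 $\tau(u)=\int_0^ua(\zeta)d\zeta$, $b_i=a/Y_i$. $\xi\in\mathbb{R}^m_{>0}$ is the unique point with $\xi_i>0$ and $F_i(\xi)=0$ for all $i$; the Einstein metric corresponding to $\xi$ is $\sigma\otimes\sigma+\sum_i\xi_i^{-1}g_i$ (up to homothety). If $Y(u)\to\xi$ as $u\to\infty$, then the corresponding $g_{a,\vec b}(\tau)$ is an ancient solution, defined for all $\tau\ge0$; modulo translation in $u$ the nonconstant such $Y$ form a $C^0$-family with $m-2$ parameters. *)

(* Defs.v *)
From HB Require Import structures.
From mathcomp Require Import all_boot all_order all_algebra.
From mathcomp Require Import all_classical all_reals all_analysis.

Set Implicit Arguments.
Unset Strict Implicit.
Unset Printing Implicit Defensive.

Import Order.TTheory GRing.Theory Num.Theory.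
Import numFieldNormedType.Exports.

Local Open Scope classical_set_scope.
Local Open Scope ring_scope.

(* Throughout, [n i] is the complex dimension of the Kähler-Einstein factor M_i,
   [p i] its Einstein constant, and [q] the integers defining the Euler class
   (1/2pi) \sum_i q_i [omega_i] of the circle bundle P_Q. *)

Definition E (R : realType) (m : nat) (n : 'I_m -> nat) (q : 'I_m -> int)
    (Y : 'rV[R]_m) : R :=
  \sum_i (n i)%:R * (q i)%:~R ^+ 2 * Y ord0 i ^+ 2.

Definition F (R : realType) (m : nat) (n p : 'I_m -> nat) (q : 'I_m -> int)
    (i : 'I_m) (Y : 'rV[R]_m) : R :=
  2 * (p i)%:R * Y ord0 i - (q i)%:~R ^+ 2 * Y ord0 i ^+ 2 - E n q Y.

(* f' = f1 on the closed half-line.  Values of f at negative arguments are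
   irrelevant: the equation is required at positive times, with continuity up
   to 0.  When f1 is continuous on the closed half-line, this gives
   the one-sided derivative at 0 as well. *)
Definition ode_on_halfline (R : realType) (f f1 : R -> R) : Prop :=
  {within `[0, +oo[, continuous f} /\
  forall x : R, 0 < x -> is_derive x 1 f (f1 x).

Definition Y_solution (R : realType) (m : nat) (n p : 'I_m -> nat)
    (q : 'I_m -> int) (Y : R -> 'rV[R]_m) : Prop :=
  (forall u i, 0 <= u -> 0 < Y u ord0 i) /\
  forall i, ode_on_halfline (fun u => Y u ord0 i)
              (fun u => - Y u ord0 i * F n p q i (Y u)).

(* The backwards (tau = - t) Ricci flow for a sigma^2 + \sum_i b_i g_i, for all
   tau >= 0, i.e. a Ricci flow for all t in ]-oo, 0]. *)
Definition ancient_ricci_flow (R : realType) (m : nat) (n p : 'I_m -> nat)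
    (q : 'I_m -> int) (a : R -> R) (b : R -> 'rV[R]_m) : Prop :=
  [/\ forall tau, 0 <= tau -> 0 < a tau,
      forall tau i, 0 <= tau -> 0 < b tau ord0 i,
      ode_on_halfline a (fun tau =>
        \sum_i (n i)%:R * (q i)%:~R ^+ 2 * (a tau ^+ 2 / b tau ord0 i ^+ 2)) &
      forall i, ode_on_halfline (fun tau => b tau ord0 i) (fun tau =>
        2 * (p i)%:R - (q i)%:~R ^+ 2 * (a tau / b tau ord0 i))].

Definition a_of_u (R : realType) (m : nat) (n : 'I_m -> nat) (q : 'I_m -> int)
    (Y : R -> 'rV[R]_m) (a0 u : R) : R :=
  a0 * expR (\int[lebesgue_measure]_(z in `[0, u]) E n q (Y z)).

Definition tau_of_u (R : realType) (m : nat) (n : 'I_m -> nat)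
    (q : 'I_m -> int) (Y : R -> 'rV[R]_m) (a0 u : R) : R :=
  \int[lebesgue_measure]_(z in `[0, u]) a_of_u n q Y a0 z.

(* When Y converges to a point of the open orthant, tau_of_u is a bijection of
   [0, +oo[ onto itself, so this determines a and b on [0, +oo[. *)
Definition corresponds_to (R : realType) (m : nat) (n : 'I_m -> nat)
    (q : 'I_m -> int) (Y : R -> 'rV[R]_m) (a0 : R)
    (a : R -> R) (b : R -> 'rV[R]_m) : Prop :=
  forall u, 0 <= u ->
    a (tau_of_u n q Y a0 u) = a_of_u n q Y a0 u /\
    forall i, b (tau_of_u n q Y a0 u) ord0 i = a_of_u n q Y a0 u / Y u ord0 i.

(* The metric a sigma^2 + \sum_i b_i g_i, as a vector in a space V of symmetric
   2-tensor fields on P_Q; sigma2 stands for sigma \otimes sigma and g i for the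
   pull-back of g_i.  For V with its C^k or C^oo topology, convergence in V is
   convergence of metrics in that sense. *)
Definition bundle_metric (R : realType) (m : nat) (V : lmodType R)
    (sigma2 : V) (g : 'I_m -> V) (a : R) (b : 'rV[R]_m) : V :=
  a *: sigma2 + \sum_i b ord0 i *: g i.

Definition einstein_metric (R : realType) (m : nat) (V : lmodType R)
    (sigma2 : V) (g : 'I_m -> V) (xi : 'rV[R]_m) : V :=
  bundle_metric sigma2 g 1 (\row_i (xi ord0 i)^-1).

(* Main.v *)
Require Import Defs.
From mathcomp Require Import all_boot all_order all_algebra.
From mathcomp Require Import all_classical all_reals all_analysis.
From mathcomp Require Import ring lra.

Set Implicit Arguments.
Unset Strict Implicit.
Unset Printing Implicit Defensive.

Import Order.TTheory GRing.Theory Num.Theory.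
Import numFieldNormedType.Exports.

Local Open Scope classical_set_scope.
Local Open Scope ring_scope.

(* Along the flow a / b_i = Y_i(u), and u |-> tau(u) is continuous and at least
   a(0) u, so it maps [U, +oo[ onto a set containing [tau(U), +oo[; hence
   a / b_i --> xi_i as tau --> +oo. The right-hand sides of the Ricci flow
   depend on the a / b_i only, so da/dtau --> E(xi) and db_i/dtau -->
   2 p_i - q_i^2 xi_i, which equals E(xi) / xi_i since F_i(xi) = 0. The mean
   value theorem turns these limits into the linear bounds, hence into the
   asymptotic slopes; the convergence of metrics follows by continuity of
   addition and scaling. *)

(** * Continuity and sign of E *)

Lemma E_cvg (R : realType) (m : nat) (n : 'I_m -> nat) (q : 'I_m -> int)
    (T : Type) (G : set_system T) (Y : T -> 'rV[R]_m) (l : 'rV[R]_m) :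
  Filter G -> (forall i, Y t ord0 i @[t --> G] --> l ord0 i) ->
  E n q (Y t) @[t --> G] --> E n q l.
Proof.
move=> FG cY; apply: cvg_big => [|i _]; first exact: add_continuous.
apply: cvgM; first exact: cvg_cst.
by rewrite expr2; under eq_fun do rewrite expr2; exact: cvgM.
Qed.

Lemma E_ge0 (R : realType) (m : nat) (n : 'I_m -> nat) (q : 'I_m -> int)
  (y : 'rV[R]_m) : 0 <= E n q y.
Proof.
by apply: sumr_ge0 => i _; rewrite mulr_ge0 ?sqr_ge0// mulr_ge0 ?sqr_ge0.
Qed.

(** * The time change from u to tau *)

Section inverse_time_change.
Context (R : realType) (m : nat) (n p : 'I_m -> nat) (q : 'I_m -> int).
Variables (Y : R -> 'rV[R]_m) (a0 : R).
Hypotheses (hY : Y_solution n p q Y) (ha0 : 0 < a0).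
Local Notation mu := (@lebesgue_measure R).

Lemma solution_within_continuous i U :
  {within `[0, U], continuous (fun u => Y u ord0 i)}.
Proof.
have [_ /(_ i) [cY _]] := hY; apply: continuous_subspaceW cY.
exact: subset_itvl.
Qed.

Lemma E_solution_integrable U : mu.-integrable `[0, U] (EFin \o (E n q \o Y)).
Proof.
apply: continuous_compact_integrable; first exact: segment_compact.
by move=> u; apply: E_cvg => i; exact: solution_within_continuous.
Qed.

Lemma a_of_u_continuous U : 0 <= U ->
  {within `[0, U], continuous (a_of_u n q Y a0)}.
Proof.
move=> U0 u; apply: cvgM; first exact: cvg_cst.
apply: continuous_comp; last exact: continuous_expR.
exact: (parameterized_integral_continuous U0 (E_solution_integrable U)).
Qed.

(** The exponent is the integral of E >= 0. For negative u it is an integral over the empty set, so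
    no sign of u is required. *)
Lemma a_of_u_ge u : a0 <= a_of_u n q Y a0 u.
Proof.
rewrite ler_peMr ?(ltW ha0)// -expR0 ler_expR.
by apply: Rintegral_ge0 => z _; exact: E_ge0.
Qed.

Lemma a_of_u_integrable U : 0 <= U ->
  mu.-integrable `[0, U] (EFin \o a_of_u n q Y a0).
Proof.
move=> U0; apply: continuous_compact_integrable; first exact: segment_compact.
exact: a_of_u_continuous.
Qed.

Lemma tau_of_u_continuous U : 0 <= U ->
  {within `[0, U], continuous (tau_of_u n q Y a0)}.
Proof.
move=> U0.
exact: (parameterized_integral_continuous U0 (a_of_u_integrable U0)).
Qed.

(** Integrating [a_of_u_ge] gives this; it shows that tau(u) is unbounded, so that all late times
    are reached. *)
Lemma tau_of_u_ge u : 0 <= u -> a0 * u <= tau_of_u n q Y a0 u.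
Proof.
move=> u0; have : \int[mu]_(z in `[0, u]) a0 <= tau_of_u n q Y a0 u.
  apply: le_Rintegral => //; last by move=> z _; exact: a_of_u_ge.
    apply: continuous_compact_integrable; first exact: segment_compact.
    by move=> z; exact: cvg_cst.
  exact: a_of_u_integrable.
rewrite Rintegral_cst//= lebesgue_measure_itv/= lte_fin.
(* The length of [[0, u]] is a conditional on 0 < u, hence the separate case u = 0. *)
by case: ltgtP u0 => // [u0 _|<- _]; rewrite /= ?subr0 ?mulr0.
Qed.

Lemma tau_of_u_surjective U tau : 0 <= U -> tau_of_u n q Y a0 U <= tau ->
  exists2 u, U <= u & tau_of_u n q Y a0 u = tau.
Proof.
(* Intermediate values on [U, W], as tau(W) >= a0 W >= tau. *)
move=> U0 Utau; pose W := Num.max U (tau / a0).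
have UW : U <= W by rewrite le_max lexx.
have W0 := le_trans U0 UW.
have tauW : tau <= tau_of_u n q Y a0 W.
  apply: le_trans (tau_of_u_ge W0).
  by rewrite mulrC -ler_pdivrMr// le_max lexx orbT.
have [||u] := @IVT R (tau_of_u n q Y a0) U W tau UW.
- apply: continuous_subspaceW (tau_of_u_continuous W0).
  exact: subset_itvr.
- by rewrite ge_min Utau le_max tauW orbT.
by rewrite in_itv/= => /andP[Uu _] <-; exists u.
Qed.

(** Every tau >= tau(U) is tau(u) for some u >= U, where the ratio is Y_i(u); closeness to the limit
    is thus transported pointwise, without building an inverse function. *)
Lemma ratio_cvg (l : 'rV[R]_m) (a : R -> R) (b : R -> 'rV[R]_m) i :
  corresponds_to n q Y a0 a b ->
  Y u @[u --> +oo] --> l ->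
  a tau / b tau ord0 i @[tau --> +oo] --> l ord0 i.
Proof.
move=> hab Yl.
have Yil : Y u ord0 i @[u --> +oo] --> l ord0 i.
  apply: (@continuous_cvg _ _ _ _ _ _ (fun y : 'rV[R]_m => y ord0 i)) Yl.
  exact: coord_continuous.
apply/cvgrPdist_le => e e0.
(* Neighbourhoods of +oo give a strict bound M < u, hence the + 1; the maximum keeps U
   nonnegative. *)
have /cvgrPdist_le /(_ e e0) [M [_ HM]] := Yil; pose U := Num.max 0 M + 1.
have U0 : 0 <= U by rewrite addr_ge0// le_max lexx.
near=> tau.
have [|u Uu <-] := @tau_of_u_surjective U tau U0.
  by near: tau; apply: nbhs_pinfty_ge; rewrite num_real.
have [-> ->] := hab u (le_trans U0 Uu).
have a_neq0 : a_of_u n q Y a0 u != 0.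
  by rewrite gt_eqF// (lt_le_trans ha0)// a_of_u_ge.
rewrite invf_div mulrCA divff// mulr1.
apply: HM; apply: lt_le_trans Uu.
by rewrite /U ltr_pwDr// le_max lexx orbT.
Unshelve. all: by end_near. Qed.

End inverse_time_change.

(** * Linear growth from the limit of the derivative *)

Lemma halfline_increment_bounds (R : realType) (f f1 : R -> R) (L e s t : R) :
  ode_on_halfline f f1 -> 0 <= s -> s <= t ->
  (forall x, s <= x -> `|L - f1 x| <= e) ->
  (L - e) * (t - s) <= f t - f s <= (L + e) * (t - s).
Proof.
move=> [cf df] s0 st f1L.
have [x xst| |x xst ->] := @MVT_segment R f f1 s t st.
- by apply: df; rewrite (le_lt_trans s0)// (itvP xst).
- apply: continuous_subspaceW cf => x/=; rewrite !in_itv/= andbT => /andP[+ _].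
  exact: le_trans.
have : `|L - f1 x| <= e by apply: f1L; rewrite (itvP xst).
rewrite ler_distlC => /andP[h1 h2].
by rewrite !ler_wpM2r ?subr_ge0//; lra.
Qed.

Lemma halfline_growth (R : realType) (f f1 : R -> R) (L : R) :
  ode_on_halfline f f1 -> f1 x @[x --> +oo] --> L ->
  f x / x @[x --> +oo] --> L.
Proof.
move=> odef f1L; apply/cvgrPdist_le => e e0.
have e20 : 0 < e / 2 by rewrite divr_gt0.
have /cvgrPdist_le /(_ _ e20) [M [_ HM]] := f1L.
pose s := Num.max 0 M + 1.
have s0 : 0 <= s by rewrite addr_ge0// le_max lexx.
have Ms : M < s by rewrite /s ltr_pwDr// le_max lexx orbT.
near=> t.
have st : s <= t by near: t; apply: nbhs_pinfty_ge; rewrite num_real.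
have t0 : 0 < t by near: t; apply: nbhs_pinfty_gt; rewrite num_real.
(* From this time on, the constant f(s) - L s left over from starting at s costs at most e/2 t. *)
have tbig : `|f s - L * s| / (e / 2) <= t.
  by near: t; apply: nbhs_pinfty_ge; rewrite num_real.
rewrite ler_pdivrMr// in tbig.
have /andP[lo hi] := halfline_increment_bounds odef s0 st
  (fun x sx => HM x (lt_le_trans Ms sx)).
rewrite ler_distlC ler_pdivlMr// ler_pdivrMr//.
move: tbig; rewrite ler_norml => /andP[h1 h2].
(* f(t) - L t is the error e/2 (t - s) of the increment plus that constant; dropping e/2 s leaves at
   most e t. *)
have es : 0 <= e / 2 * s by rewrite mulr_ge0// ltW.
by apply/andP; split; nra.
Unshelve. all: by end_near. Qed.

(** * Convergence of the metrics *)

Lemma cvg_bundle_metric (R : realType) (m : nat) (V : tvsType R) (sigma2 : V)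
    (g : 'I_m -> V) (T : Type) (G : set_system T) (a : T -> R)
    (b : T -> 'rV[R]_m) (la : R) (lb : 'rV[R]_m) :
  Filter G -> a t @[t --> G] --> la ->
  (forall i, b t ord0 i @[t --> G] --> lb ord0 i) ->
  bundle_metric sigma2 g (a t) (b t) @[t --> G]
    --> bundle_metric sigma2 g la lb.
Proof.
move=> FG al bl.
have scale (v : V) (c : T -> R) (l : R) :
    c t @[t --> G] --> l -> c t *: v @[t --> G] --> l *: v.
  move=> cl; apply: (@continuous2_cvg _ R^o V V _ _ c (fun=> v) *:%R l v) cl _.
    exact: (@scale_continuous R V (l, v)).
  exact: cvg_cst.
apply: (@continuous2_cvg _ V V V _ _ _ _ +%R) (scale _ _ _ al) _.
  exact: (@add_continuous V (_, _)).
by apply: cvg_big => [|i _]; [exact: add_continuous|exact: scale].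
Qed.

Lemma scale_bundle_metric (R : realType) (m : nat) (V : lmodType R)
    (sigma2 : V) (g : 'I_m -> V) (c a : R) (b : 'rV[R]_m) :
  c *: bundle_metric sigma2 g a b = bundle_metric sigma2 g (c * a) (c *: b).
Proof.
rewrite /bundle_metric scalerDr scalerA scaler_sumr; congr (_ + _).
by apply: eq_bigr => i _; rewrite mxE scalerA.
Qed.

Theorem theorem3p8 (R : realType) (m : nat)
    (n p : 'I_m -> nat) (q : 'I_m -> int)
    (hn : forall i, (0 < n i)%N) (hp : forall i, (0 < p i)%N)
    (hq : forall i, q i != 0)
    (xi : 'rV[R]_m)
    (hxi_pos : forall i, 0 < xi ord0 i) (hxi : forall i, F n p q i xi = 0)
    (Y : R -> 'rV[R]_m)
    (hY : Y_solution n p q Y)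
    (hY_nonconst : exists2 u, 0 <= u & Y u <> Y 0)
    (hY_lim : Y u @[u --> +oo] --> xi)
    (a0 : R) (ha0 : 0 < a0)
    (a : R -> R) (b : R -> 'rV[R]_m)
    (hab : corresponds_to n q Y a0 a b)
    (hflow : ancient_ricci_flow n p q a b)
    (* V: any locally convex space of symmetric 2-tensor fields on the bundle *)
    (V : tvsType R) (sigma2 : V) (g : 'I_m -> V) :
  [/\ \forall eps \near 0^'+, exists2 tau0, 0 < tau0 & forall tau, tau0 <= tau ->
        (forall i,
          (2 * (p i)%:R - (q i)%:~R ^+ 2 * (xi ord0 i + eps)) * (tau - tau0)
             <= b tau ord0 i - b tau0 ord0 i
             <= (2 * (p i)%:R - (q i)%:~R ^+ 2 * (xi ord0 i - eps))
                  * (tau - tau0)) /\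
        (E n q xi - eps) * (tau - tau0) <= a tau - a tau0
           <= (E n q xi + eps) * (tau - tau0),
      a tau / tau @[tau --> +oo] --> E n q xi,
      forall i, b tau ord0 i / tau @[tau --> +oo] --> E n q xi * (xi ord0 i)^-1 &
      exists2 c : R, 0 < c &
        tau^-1 *: bundle_metric sigma2 g (a tau) (b tau) @[tau --> +oo]
          --> c *: einstein_metric sigma2 g xi].
Proof.
have hr i := ratio_cvg hY ha0 (i := i) hab hY_lim.
have [a_pos b_pos oda odb] := hflow.
(* The ratios as a point of the Y-space: the right-hand side for a becomes E at this point. *)
pose r tau : 'rV[R]_m := \row_i (a tau / b tau ord0 i).
have rE tau i : r tau ord0 i = a tau / b tau ord0 i by rewrite mxE.
have Er tau : E n q (r tau) =
    \sum_i (n i)%:R * (q i)%:~R ^+ 2 * (a tau ^+ 2 / b tau ord0 i ^+ 2).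
  by apply: eq_bigr => i _; rewrite rE expr_div_n.
have a1 : E n q (r tau) @[tau --> +oo] --> E n q xi.
  by apply: E_cvg => i; under eq_fun do rewrite rE; exact: hr.
have oda' : ode_on_halfline a (fun tau => E n q (r tau)).
  by rewrite (funext Er).
have b1 i : 2 * (p i)%:R - (q i)%:~R ^+ 2 * (a tau / b tau ord0 i)
    @[tau --> +oo] --> 2 * (p i)%:R - (q i)%:~R ^+ 2 * xi ord0 i.
  by apply: cvgB; [exact: cvg_cst|apply: cvgM; [exact: cvg_cst|exact: hr]].
have bE i : 2 * (p i)%:R - (q i)%:~R ^+ 2 * xi ord0 i
    = E n q xi * (xi ord0 i)^-1.
  have xi_neq0 : xi ord0 i != 0 by rewrite gt_eqF.
  have Exi : E n q xi
      = 2 * (p i)%:R * xi ord0 i - (q i)%:~R ^+ 2 * xi ord0 i ^+ 2.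
    by have /eqP := hxi i; rewrite /F subr_eq0 => /eqP.
  by rewrite Exi; field.
have a_lim := halfline_growth oda' a1.
have b_lim i : b tau ord0 i / tau @[tau --> +oo] --> E n q xi * (xi ord0 i)^-1.
  by rewrite -bE; exact: halfline_growth (odb i) (b1 i).
split=> //; last first.
- (* A nonconstant Y forces m > 0, hence E xi > 0. *)
  exists (E n q xi).
    have [u _ Yu] := hY_nonconst.
    have [i _] : exists i, Y u ord0 i != Y 0 ord0 i.
      apply: contrapT => /forallNP YY; apply: Yu; apply/rowP => i.
      by apply/eqP/negPn/negP; exact: YY.
    rewrite lt_neqAle E_ge0 andbT eq_sym psumr_neq0.
      apply/hasP; exists i; first by rewrite mem_index_enum.
      rewrite /= pmulr_lgt0 ?exprn_gt0//.
      by rewrite mulr_gt0 ?ltr0n// exprn_even_gt0//= intr_eq0.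
    by move=> j _; rewrite mulr_ge0 ?sqr_ge0// mulr_ge0 ?sqr_ge0.
  (* The multiple E(xi) of the Einstein metric has coefficients E(xi) and E(xi) / xi_i, the limits
     of a / tau and b_i / tau. *)
  rewrite scale_bundle_metric.
  under eq_fun do rewrite scale_bundle_metric.
  apply: cvg_bundle_metric.
    by rewrite mulr1; under eq_fun do rewrite mulrC; exact: a_lim.
  by move=> i'; rewrite !mxE; under eq_fun do rewrite mxE mulrC; exact: b_lim.
apply: filterS (nbhs_right_gt 0) => eps eps0.
(* One threshold for a and all b_i at once, as there are finitely many i. *)
have : \forall tau \near +oo, `|E n q xi - E n q (r tau)| <= eps /\
    forall i, `|xi ord0 i - a tau / b tau ord0 i| <= eps.
  near=> tau; split; first by near: tau; move/cvgrPdist_le: a1; exact.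
  near: tau; apply: filter_forall => i.
  by move/cvgrPdist_le: (hr i); exact.
move=> [M [_ HM]]; pose s := Num.max 0 M + 1.
have s0 : 0 < s by rewrite ltr_pwDr// le_max lexx.
have Ms x : s <= x -> M < x.
  by apply: lt_le_trans; rewrite ltr_pwDr// le_max lexx orbT.
exists s => // tau stau; split=> [i|]; last first.
  apply: (halfline_increment_bounds oda') => // [|x /Ms /HM[]//].
  exact: ltW.
have q2 : 0 <= ((q i)%:~R : R) ^+ 2 by exact: sqr_ge0.
set L := 2 * (p i)%:R - (q i)%:~R ^+ 2 * xi ord0 i.
have -> : 2 * (p i)%:R - (q i)%:~R ^+ 2 * (xi ord0 i + eps)
    = L - (q i)%:~R ^+ 2 * eps by rewrite /L; ring.
have -> : 2 * (p i)%:R - (q i)%:~R ^+ 2 * (xi ord0 i - eps)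
    = L + (q i)%:~R ^+ 2 * eps by rewrite /L; ring.
(* The tolerance is q_i^2 eps: the slope of b_i differs from L by q_i^2 times the deviation of the
   ratio from xi_i. *)
apply: (halfline_increment_bounds (odb i)) => // [|x /Ms /HM[_ /(_ i) hx]].
  exact: ltW.
rewrite (_ : L - _ = - (q i)%:~R ^+ 2 * (xi ord0 i - a x / b x ord0 i)).
  by rewrite normrM normrN (ger0_norm q2) ler_wpM2l.
by rewrite /L; ring.
Unshelve. all: by end_near. Qed.
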